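(* Let $g,h,g',h'\in\mathbb R$ be such that the algebras $\mathcal A_{g,h}$ and $\mathcal A_{g',h'}$ are both partially alternative division algebras. Then $\mathcal A_{g,h}$ and $\mathcal A_{g',h'}$ are isomorphic as real algebras if and only if $g=g'$ and $h=\pm h'$.
   Context: For $g,h\in\mathbb R$, $\mathcal A_{g,h}$ is the four-dimensional real (nonassociative) algebra with basis $\{1,i,j,k\}$ and bilinear product given by the table (entry in row $x$ and column $y$ is $xy$): $$\begin{array}{c|cccc} & 1 & i & j & k\\ \hline 1 & 1 & i & j & k\\ i & i & -1 & -k & j\\ j & j & k & -1 & -i\\ k & k & -j & i & g1+hi\end{array}$$ A finite-dimensional real algebra is a division algebra if left and right multiplications by every nonzero element are bijective. For a unital real algebra $\mathcal A$, an imaginary unit is an element $q$ with $q^2=-1$, and $\mathcal I_{\mathcal A}$ is the set of imaginary units. With $(a,b,c)=(ab)c-a(bc)$, $\mathcal A$ is partially alternative if $\mathcal I_{\mathcal A}\neq\emptyset$ and $(x,x,y)=(x,y,x)=(y,x,x)=0$ for all $x\in\mathcal I_{\mathcal A}$ and $y\in\mathcal A$. *)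

(* Defs.v *)
From HB Require Import structures.
From mathcomp Require Import all_boot all_order all_algebra.
From mathcomp Require Import reals.
Set Implicit Arguments.
Unset Strict Implicit.
Unset Printing Implicit Defensive.
Import GRing.Theory.
Local Open Scope ring_scope.

(* MathComp's algebra structures are associative; these are not assumed to be
   associative, commutative or nontrivial. *)
Record unitalAlgebra (R : realType) := UnitalAlgebra {
  acarrier :> vectType R;
  amul : {bilinear acarrier -> acarrier -> acarrier};
  aone : acarrier;
  amul1l : left_id aone amul;
  amul1r : right_id aone amul
}.

Section Notions.
Variables (R : realType) (A : unitalAlgebra R).
Implicit Types x y z q : A.

Definition division_algebra : Prop :=
  forall x, x != 0 -> bijective (fun y => amul A x y)
                   /\ bijective (fun y => amul A y x).

Definition imaginary_unit q : Prop := amul A q q = - aone A.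

Definition associator x y z : A :=
  amul A (amul A x y) z - amul A x (amul A y z).

Definition partially_alternative : Prop :=
  (exists q, imaginary_unit q) /\
  (forall x y, imaginary_unit x ->
     [/\ associator x x y = 0, associator x y x = 0 & associator y x x = 0]).

End Notions.

Definition alg_isomorphic (R : realType) (A B : unitalAlgebra R) : Prop :=
  exists f : {linear A -> B},
    bijective f /\ forall x y, f (amul A x y) = amul B (f x) (f y).

Section TheFamily.
Variables (R : realType) (g h : R).

(* bas 0, bas 1, bas 2, bas 3 are the basis 1, i, j, k. *)
Definition bas (n : nat) : 'rV[R]_4 := delta_mx 0 (inord n).

Local Notation "'b1" := (bas 0).
Local Notation "'bi" := (bas 1).
Local Notation "'bj" := (bas 2).
Local Notation "'bk" := (bas 3).

Definition Agh_table : seq (seq 'rV[R]_4) :=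
  [:: [:: 'b1;   'bi;   'bj;   'bk ];
      [:: 'bi; - 'b1; - 'bk;   'bj ];
      [:: 'bj;   'bk; - 'b1; - 'bi ];
      [:: 'bk; - 'bj;   'bi; g *: 'b1 + h *: 'bi ]].

Definition Agh_entry (a b : nat) : 'rV[R]_4 := (nth [::] Agh_table a)`_b.

Definition Agh_mul (x y : 'rV[R]_4) : 'rV[R]_4 :=
  \sum_(a < 4) \sum_(b < 4) (x 0 a * y 0 b) *: Agh_entry a b.

Lemma Agh_mul_bilinear :
  bilinear_for (GRing.Scale.Law.clone _ _ *:%R _)
               (GRing.Scale.Law.clone _ _ *:%R _) Agh_mul.
Proof.
split=> [z c x y | z c x y] /=; rewrite /Agh_mul scaler_sumr -big_split /=;
  apply: eq_bigr => a _; rewrite scaler_sumr -big_split /=;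
  apply: eq_bigr => b _; rewrite !mxE scalerA -scalerDl; congr (_ *: _).
- by rewrite mulrDl mulrA.
- by rewrite mulrDr mulrCA.
Qed.

HB.instance Definition _ :=
  bilinear_isBilinear.Build R _ _ _ _ _ Agh_mul Agh_mul_bilinear.

Lemma Agh_mul_bas (a b : 'I_4) :
  Agh_mul (bas a) (bas b) = Agh_entry a b.
Proof.
rewrite /Agh_mul /bas !inord_val (bigD1 a) //= [X in _ + X]big1 => [|c ca].
  rewrite addr0 (bigD1 b) //= big1 ?addr0 => [|c cb].
    by rewrite !mxE !eqxx mulr1 scale1r.
  by rewrite !mxE (negPf cb) andbF mulr0 scale0r.
by rewrite big1 // => d _; rewrite !mxE (negPf ca) andbF mul0r scale0r.
Qed.

Lemma Agh_mul1l : left_id (bas 0) Agh_mul.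
Proof.
move=> x; rewrite /Agh_mul /bas (bigD1 (inord 0)) //= [X in _ + X]big1.
  rewrite addr0 [RHS]row_sum_delta; apply: eq_bigr => -[b ltb4] _.
  rewrite mxE !eqxx mul1r /Agh_entry inordK //=; congr (_ *: _).
  rewrite -[Ordinal ltb4]inord_val /=.
  by case: b ltb4 => [|[|[|[|b]]]].
by move=> a a0; rewrite big1 // => b _; rewrite mxE (negPf a0) mul0r scale0r.
Qed.

Lemma Agh_mul1r : right_id (bas 0) Agh_mul.
Proof.
move=> x; rewrite [RHS]row_sum_delta /Agh_mul; apply: eq_bigr => -[a lta4] _.
rewrite /bas (bigD1 (inord 0)) //= [X in _ + X]big1.
  rewrite addr0 mxE !eqxx mulr1 /Agh_entry inordK //=; congr (_ *: _).
  rewrite -[in RHS](inord_val (Ordinal lta4)) /=.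
  by case: a lta4 => [|[|[|[|a]]]].
by move=> b b0; rewrite mxE (negPf b0) mulr0 scale0r.
Qed.

Definition Agh : unitalAlgebra R :=
  @UnitalAlgebra R 'rV[R]_4 Agh_mul (bas 0) Agh_mul1l Agh_mul1r.

End TheFamily.

(* Main.v *)
Require Import Defs.
From HB Require Import structures.
From mathcomp Require Import all_boot all_order all_algebra.
From mathcomp Require Import reals.
From mathcomp Require Import ring lra.
Set Implicit Arguments.
Unset Strict Implicit.
Unset Printing Implicit Defensive.
Import GRing.Theory.
Local Open Scope ring_scope.

(** An isomorphism [f] from [Agh g h] to [Agh g' h'] maps [i], [j] to anticommuting
    imaginary units and [k = j i] to [f j * f i].  If [h' != 0], the imaginary units of
    [Agh g' h'] are the unit circle of the plane spanned by [i] and [j], so [f k] is [k]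
    or [- k], and applying [f] to [k ^ 2 = g + h i] gives [g' + h' i = g + h (f i)].
    If [h' = 0], partial alternativity and the division property force [g' = -1], i.e.
    the target is the quaternion algebra up to sign conventions; there [f k] squares to
    [-1], whence [g + h (f i) = -1].  Conversely [diag (1, -1, 1, -1)] is an isomorphism
    from [Agh g (- h)] to [Agh g h]. *)

Section Coordinates.
Variable R : realType.
Implicit Types a b c d g h s : R.

(** Explicit coordinates over [1, i, j, k] turn each identity in the algebra into four real
    equations, within reach of [ring] and [lra]. *)
Definition vec4 a b c d : 'rV[R]_4 := \row_(n < 4) [:: a; b; c; d]`_n.

Lemma vec4E (x : 'rV[R]_4) : exists a b c d, x = vec4 a b c d.
Proof.
exists (x 0 (inord 0)), (x 0 (inord 1)), (x 0 (inord 2)), (x 0 (inord 3)).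
apply/rowP => n; rewrite mxE -{1}[n]inord_val.
by case: n => [[|[|[|[|n]]]]].
Qed.

Lemma vec4_inj a b c d a' b' c' d' :
  vec4 a b c d = vec4 a' b' c' d' -> [/\ a = a', b = b', c = c' & d = d'].
Proof.
move=> /rowP e; have eE n (ltn4 : (n < 4)%N) := e (Ordinal ltn4).
by move: (eE 0 isT) (eE 1 isT) (eE 2 isT) (eE 3 isT); rewrite !mxE.
Qed.

Lemma basE n : (n < 4)%N ->
  bas R n = vec4 (n == 0)%:R (n == 1)%:R (n == 2)%:R (n == 3)%:R.
Proof.
move=> lt_n4; apply/rowP => m; rewrite !mxE eqxx -(inj_eq val_inj) /= inordK //.
by case: m => [[|[|[|[|m]]]] ltm] //; case: n lt_n4 => [|[|[|[|n]]]].
Qed.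

Lemma vec4D a b c d a' b' c' d' :
  vec4 a b c d + vec4 a' b' c' d' = vec4 (a + a') (b + b') (c + c') (d + d').
Proof. by apply/rowP => -[[|[|[|[|n]]]] ltn] //; rewrite !mxE. Qed.

Lemma vec4Z s a b c d : s *: vec4 a b c d = vec4 (s * a) (s * b) (s * c) (s * d).
Proof. by apply/rowP => -[[|[|[|[|n]]]] ltn] //; rewrite !mxE. Qed.

Lemma vec4N a b c d : - vec4 a b c d = vec4 (- a) (- b) (- c) (- d).
Proof. by apply/rowP => -[[|[|[|[|n]]]] ltn] //; rewrite !mxE. Qed.

Lemma vec4_0 : 0 = vec4 0 0 0 0.
Proof. by apply/rowP => -[[|[|[|[|n]]]] ltn] //; rewrite !mxE. Qed.

Lemma amul_AghE g h a b c d a' b' c' d' :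
  amul (Agh g h) (vec4 a b c d) (vec4 a' b' c' d') =
  vec4 (a * a' - b * b' - c * c' + g * (d * d'))
       (a * b' + b * a' - c * d' + d * c' + h * (d * d'))
       (a * c' + c * a' + b * d' - d * b')
       (a * d' + d * a' - b * c' + c * b').
Proof.
rewrite [LHS]/(Agh_mul g h _ _) /Agh_mul !big_ord_recl !big_ord0 !mxE /Agh_entry /=.
rewrite !basE // !(vec4Z, vec4N, vec4D) vec4_0 !vec4D /=.
by congr vec4; ring.
Qed.

Lemma aone_Agh g h : aone (Agh g h) = vec4 1 0 0 0.
Proof. exact: basE. Qed.

Lemma zero_Agh g h : (0 : Agh g h) = vec4 0 0 0 0.
Proof. exact: vec4_0. Qed.

(** The last three coordinates of the square are [2ab + h d^2], [2ac] and [2ad]. If [a] is nonzero,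
    they force [c = d = 0] and then [b = 0], leaving [a^2 = -1]. *)
Lemma imaginary_unit_vec4 g h a b c d :
  @imaginary_unit R (Agh g h) (vec4 a b c d) <->
  [/\ a = 0, h * (d * d) = 0 & b * b + c * c - g * (d * d) = 1].
Proof.
rewrite /imaginary_unit aone_Agh vec4N.
split=> [|[-> hd bcd]]; last first.
  rewrite [LHS]amul_AghE; congr vec4; nra.
move=> /(etrans (esym (amul_AghE _ _ _ _ _ _ _ _ _ _))) /vec4_inj[e1 ei ej ek].
have a0 : a = 0.
  apply/eqP/negPn/negP => an0.
  have c0 : c = 0 by apply: (mulfI an0); lra.
  have d0 : d = 0 by apply: (mulfI an0); lra.
  have b0 : b = 0.
    by apply: (mulfI an0); rewrite c0 d0 in ei; lra.
  by rewrite b0 c0 d0 in e1; nra.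
by rewrite a0 in e1 ei; split=> //; lra.
Qed.

Lemma pa_division_h0 g : partially_alternative (Agh g 0) ->
  division_algebra (Agh g 0) -> g = -1.
Proof.
move=> [_ pa] dv.
have g_lt0 : g < 0.
  rewrite Order.TotalTheory.ltNge; apply/negP => g_ge0.
  (* [k - s] and [k + s] are zero divisors, as [(k - s) (k + s) = g - s ^ 2]. *)
  set s := Num.sqrt g.
  have ss : s * s = g by rewrite -expr2 Num.Theory.sqr_sqrtr.
  have kn0 : (vec4 (- s) 0 0 1 : Agh g 0) != 0.
    by rewrite zero_Agh; apply/eqP => /vec4_inj[_ _ _ /eqP]; rewrite oner_eq0.
  have [/bij_inj kinj _] := dv _ kn0.
  have : (vec4 s 0 0 1 : Agh g 0) = 0.
    apply: kinj; rewrite linear0 [LHS]amul_AghE [RHS]zero_Agh.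
    by congr vec4; lra.
  by rewrite zero_Agh => /vec4_inj[_ _ _ /eqP]; rewrite oner_eq0.
(* [t k] is an imaginary unit, so [(t k) ((t k) i) = - i], which forces [t ^ 2 = 1]. *)
set t := Num.sqrt (- g^-1).
have tt : g * (t * t) = -1.
  rewrite -expr2 Num.Theory.sqr_sqrtr; last first.
    by rewrite Num.Theory.oppr_ge0 Num.Theory.invr_le0 Order.POrderTheory.ltW.
  by rewrite mulrN mulfV // Order.POrderTheory.lt_eqF.
have [|+ _ _] := pa (vec4 0 0 0 t) (vec4 0 1 0 0).
  by apply/imaginary_unit_vec4; split; lra.
rewrite /associator zero_Agh !amul_AghE vec4N vec4D => /vec4_inj[_ + _ _].
move=> ei; have t2 : t * t = 1 by lra.
by rewrite t2 mulr1 in tt.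
Qed.

(** As [k = j i], the relation [k^2 = g + h i] involves only [i] and [j], whose images are [p] and
    [q]. *)
Lemma alg_isomorphic_relations g h g' h' : alg_isomorphic (Agh g h) (Agh g' h') ->
  exists p q : Agh g' h',
    [/\ imaginary_unit p, imaginary_unit q, amul _ p q = - amul _ q p
      & amul _ (amul _ q p) (amul _ q p) = g *: aone _ + h *: p].
Proof.
move=> [f [[f' fK f'K] fM]].
(* Preservation of the unit is not part of [alg_isomorphic]; it follows from surjectivity, since
   [f 1] is a left unit on the image. *)
have f1 : f (aone _) = aone _.
  by rewrite -[LHS]amul1r -[X in amul _ _ X]f'K -fM amul1l f'K.
have fI x : imaginary_unit x -> imaginary_unit (f x).
  by rewrite /imaginary_unit -fM => ->; rewrite linearN f1.
exists (f (vec4 0 1 0 0)), (f (vec4 0 0 1 0)).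
split; try by apply/fI/imaginary_unit_vec4; split; lra.
  rewrite -!fM -linearN; congr (f _).
  by rewrite !amul_AghE vec4N; congr vec4; lra.
rewrite -!fM -f1 -!linearZ -linearD; congr (f _).
rewrite aone_Agh !amul_AghE !vec4Z vec4D.
by congr vec4; lra.
Qed.

Lemma alg_isomorphic_refl (A : unitalAlgebra R) : alg_isomorphic A A.
Proof. by exists idfun; split=> //; exists id. Qed.

(** Being a matrix product, the map inherits linearity from [*m]. *)
Definition flip_ik (x : 'rV[R]_4) : 'rV[R]_4 := x *m diag_mx (vec4 1 (-1) 1 (-1)).

Lemma flip_ikE a b c d : flip_ik (vec4 a b c d) = vec4 a (- b) c (- d).
Proof.
apply/rowP => n; rewrite /flip_ik mul_mx_diag !mxE.
by case: n => [[|[|[|[|n]]]] ltn] //=; rewrite ?mulr1 ?mulrN1.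
Qed.

Lemma flip_ikK : involutive flip_ik.
Proof.
by move=> x; have [a [b [c [d ->]]]] := vec4E x; rewrite !flip_ikE !opprK.
Qed.

Lemma flip_ik_is_linear : linear flip_ik.
Proof. by move=> s x y; rewrite /flip_ik mulmxDl scalemxAl. Qed.

HB.instance Definition _ :=
  GRing.isLinear.Build R 'rV[R]_4 'rV[R]_4 _ flip_ik flip_ik_is_linear.

Lemma alg_isomorphic_oppr g h : alg_isomorphic (Agh g (- h)) (Agh g h).
Proof.
exists flip_ik; split; first by exists flip_ik; exact: flip_ikK.
move=> x y; have [a [b [c [d ->]]]] := vec4E x.
have [a' [b' [c' [d' ->]]]] := vec4E y.
rewrite amul_AghE /= !flip_ikE amul_AghE.
by congr vec4; ring.
Qed.

End Coordinates.

Theorem theorem3 (R : realType) (g h g' h' : R)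
    (pa : partially_alternative (Agh g h)) (dv : division_algebra (Agh g h))
    (pa' : partially_alternative (Agh g' h'))
    (dv' : division_algebra (Agh g' h')) :
  alg_isomorphic (Agh g h) (Agh g' h') <-> g = g' /\ (h = h' \/ h = - h').
Proof.
split=> [|[<-] [<-|->]]; last 2 first.
- exact: alg_isomorphic_refl.
- exact: alg_isomorphic_oppr.
move=> /alg_isomorphic_relations[p [q]].
have [p0 [p1 [p2 [p3 ->]]]] := vec4E p; have [q0 [q1 [q2 [q3 ->]]]] := vec4E q.
move=> [/imaginary_unit_vec4[-> hp np] /imaginary_unit_vec4[-> hq nq]].
rewrite aone_Agh !amul_AghE vec4N !vec4Z vec4D.
(* [pq] says that [q p] has real part zero; [e1] to [ek] are the coordinates of
   [(q p)^2 = g + h p]. *)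
move=> /vec4_inj[pq _ _ _] /vec4_inj[e1 ei ej ek].
have [h'0|h'n0] := eqVneq h' 0.
  move: pa' dv' np nq pq e1 ei ej ek {hp hq}; rewrite h'0 => pa' dv'.
  rewrite (pa_division_h0 pa' dv') => np nq pq e1 ei ej ek.
  have qp0 : 0 * 0 - q1 * p1 - q2 * p2 + -1 * (q3 * p3) = 0 by lra.
  rewrite {}qp0 in pq e1 ei ej ek.
  have g1 : g = -1.
    (* Up to sign, [q p] is now the cross product of [q] and [p], so [e1] gives [g] as minus its
       squared norm; Lagrange's identity expands it. *)
    have -> : g = (p1 * q1 + p2 * q2 + p3 * q3) ^+ 2
      - (p1 * p1 + p2 * p2 + p3 * p3) * (q1 * q1 + q2 * q2 + q3 * q3) by lra.
    have -> : p1 * q1 + p2 * q2 + p3 * q3 = 0 by lra.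
    have -> : p1 * p1 + p2 * p2 + p3 * p3 = 1 by lra.
    by lra.
  (* The square of [q p] is real, so [h p = 0], while [p] has norm 1. *)
  have hp1 : h * p1 = 0 by lra.
  have hp2 : h * p2 = 0 by lra.
  have hp3 : h * p3 = 0 by lra.
  have h0 : h = 0.
    have -> : h = h * p1 * p1 + h * p2 * p2 + h * p3 * p3.
      by rewrite -[LHS]mulr1 -np; ring.
    by rewrite hp1 hp2 hp3; ring.
  by split=> //; left.
have p30 : p3 = 0.
  by move/eqP: hp; rewrite !mulf_eq0 (negPf h'n0) orbb => /eqP.
have q30 : q3 = 0.
  by move/eqP: hq; rewrite !mulf_eq0 (negPf h'n0) orbb => /eqP.
rewrite p30 q30 in np nq pq e1 ei ej ek.
have qp0 : 0 * 0 - q1 * p1 - q2 * p2 + g' * (0 * 0) = 0 by lra.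
rewrite {}qp0 in pq e1 ei ej ek.
set e := p1 * q2 - p2 * q1.
have ee : e * e = 1.
  (* Lagrange's identity; [f k] is [e k]. *)
  have -> : e * e = (p1 * p1 + p2 * p2) * (q1 * q1 + q2 * q2)
    - (p1 * q1 + p2 * q2) ^+ 2.
    by rewrite /e; ring.
  have -> : p1 * q1 + p2 * q2 = 0 by lra.
  nra.
(* With [q p = e k], the square reads [e^2 (g' + h' i) = g + h p]; the coordinates are compared one
   by one. *)
have gg' : g = g' by rewrite -[g']mulr1 -ee /e; lra.
have hh' : h * p1 = h' by rewrite -[h']mulr1 -ee /e; lra.
have hp2 : h * p2 = 0 by lra.
have hn0 : h != 0 by apply: contra_neq h'n0 => h0; rewrite -hh' h0 mul0r.
have p20 : p2 = 0 by apply: (mulfI hn0); rewrite hp2 mulr0.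
have /eqP : p1 ^+ 2 = 1 by move: np; rewrite p20; lra.
rewrite sqrf_eq1 => p1E; split=> //.
by case/orP: p1E => /eqP p1E; [left|right]; rewrite -hh' p1E; lra.
Qed.
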